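(* Let $S$ be an involution $poe$-semigroup with greatest element $e$. Then $S$ is $*$-intra-regular if and only if, for every $x\in S$, $$N(x)=\{y\in S \mid x\le ey^*e\}.$$
   Context: A $poe$-semigroup is a semigroup $S$ with a partial order $\le$ such that $a\le b$ implies $ac\le bc$ and $ca\le cb$ for all $c\in S$, and with a greatest element $e$. An involution on it is a unary operation $*$ with $(a^* )^*=a$, $(ab)^*=b^*a^*$, and $a\le b\Rightarrow a^*\le b^*$. $S$ is $*$-intra-regular if $a\le ea^*a^*e$ for all $a\in S$. A filter of $S$ is a (nonempty) subsemigroup $F$ such that (1) $a,b\in S$ and $ab\in F$ imply $a\in F$ and $b\in F$, and (2) $a\in F$, $b\in S$, $b\ge a$ imply $b\in F$. $N(x)$ denotes the filter generated by $x$, i.e. the smallest filter of $S$ containing $x$. *)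

(* Defs.v *)
From HB Require Import structures.
From mathcomp Require Import all_boot all_order.
From mathcomp Require Import boolp classical_sets.
Set Implicit Arguments.
Unset Strict Implicit.
Unset Printing Implicit Defensive.

Import Order.Theory.

Local Open Scope classical_set_scope.
Local Open Scope order_scope.
Local Open Scope group_scope.

HB.mixin Record isPoeSemigroup (d : Order.disp_t) S
    of Semigroup S & Order.TPOrder d S := {
  poe_le_mulr : forall a b c : S, a <= b -> a * c <= b * c ;
  poe_le_mull : forall a b c : S, a <= b -> c * a <= c * b
}.

#[short(type="poeSemigroupType")]
HB.structure Definition PoeSemigroup (d : Order.disp_t) :=
  { S of isPoeSemigroup d S & Semigroup S & Order.TPOrder d S }.

HB.mixin Record PoeSemigroup_hasInvolution (d : Order.disp_t) S
    of PoeSemigroup d S := {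
  star : S -> S ;
  starK : forall a : S, star (star a) = a ;
  starM : forall a b : S, star (a * b) = star b * star a ;
  le_star : forall a b : S, a <= b -> star a <= star b
}.

#[short(type="involutionPoeSemigroupType")]
HB.structure Definition InvolutionPoeSemigroup (d : Order.disp_t) :=
  { S of PoeSemigroup_hasInvolution d S & PoeSemigroup d S }.

Declare Scope poe_scope.
Notation "a ^*" := (star a) : poe_scope.
Local Open Scope poe_scope.

Definition star_intra_regular (d : Order.disp_t)
    (S : involutionPoeSemigroupType d) : Prop :=
  forall a : S, a <= \top * a^* * a^* * \top.

Record poe_filter (d : Order.disp_t) (S : poeSemigroupType d)
    (F : set S) : Prop := {
  poe_filter_nonempty : F !=set0 ;
  poe_filter_mul : forall a b : S, F a -> F b -> F (a * b) ;
  poe_filter_factors : forall a b : S, F (a * b) -> F a /\ F b ;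
  poe_filter_up : forall a b : S, F a -> a <= b -> F b
}.

(* [smallest C G] is the intersection of all sets in the class C that contain
   G; for C := poe_filter and G a singleton it is itself a filter
   (poe_filter_generated below), hence the least filter containing x. *)
Definition generated_filter (d : Order.disp_t) (S : poeSemigroupType d)
    (x : S) : set S :=
  smallest (@poe_filter d S) [set x].

Lemma generated_filter_mem (d : Order.disp_t) (S : poeSemigroupType d)
    (x : S) : generated_filter x x.
Proof. by move=> F [_]; apply. Qed.
Arguments generated_filter_mem {d S} x.

Lemma poe_filter_generated (d : Order.disp_t) (S : poeSemigroupType d)
    (x : S) : poe_filter (generated_filter x).
Proof.
split.
- by exists x; exact: generated_filter_mem.
- by move=> a b Na Nb F FF; apply: (poe_filter_mul FF.1); [exact: Na|exact: Nb].
- by move=> a b Nab; split=> F FF; have [] := poe_filter_factors FF.1 (Nab F FF).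
- by move=> a b Na ab F FF; apply: (poe_filter_up FF.1 _ ab); exact: Na.
Qed.
Arguments poe_filter_generated {d S} x.

(* Main.v *)
Require Import Defs.
From HB Require Import structures.
From mathcomp Require Import all_boot all_order.
From mathcomp Require Import boolp classical_sets.
Set Implicit Arguments.
Unset Strict Implicit.
Unset Printing Implicit Defensive.
Import Order.Theory.
Local Open Scope classical_set_scope.
Local Open Scope order_scope.
Local Open Scope group_scope.
Local Open Scope poe_scope.

Local Arguments poe_le_mulr {d s} [a b] c _.
Local Arguments poe_le_mull {d s} [a b] c _.
Local Arguments le_star {d s} [a b] _.

(** Write [e] for [\top]. Under regularity, the set of [y] with [x <= e y^* e] is a filter
    containing [x], so it contains N(x). Only closure under products is delicate: it uses regularity
    twice, at [x] and at [b e a] ([star_intra_regular_mul]). Conversely, a filter containing [x]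
    contains [e y^* e], hence its factor [y^*], hence [y] ([star_intra_regular_filter_star]). The
    other implication reads regularity off [x x] being in N(x). *)

Lemma le_top_mul_top (d : Order.disp_t) (S : poeSemigroupType d) (x y : S) :
  x <= y -> \top * x * \top <= \top * y * \top.
Proof. by move=> xy; exact/poe_le_mulr/poe_le_mull. Qed.

(** Outer factors are swallowed, since [\top * u] and [v * \top] both lie below [\top]. *)
Lemma top_mul_top_absorb (d : Order.disp_t) (S : poeSemigroupType d)
    (u v x : S) :
  (\top * u) * x * (v * \top) <= \top * x * \top.
Proof.
apply: le_trans (poe_le_mull _ (lex1 _)) _.
exact/poe_le_mulr/poe_le_mulr/lex1.
Qed.

Lemma star_top (d : Order.disp_t) (S : involutionPoeSemigroupType d) :
  (\top : S)^* = \top.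
Proof.
apply: le_anti; rewrite lex1 /= -[leLHS]starK.
exact: le_star (lex1 _).
Qed.

(** Moves the star onto [x], so that the two copies of [x^*] supplied by regularity can be
    bounded. *)
Lemma star_le_top_mul_top (d : Order.disp_t) (S : involutionPoeSemigroupType d)
    (x y : S) :
  x <= \top * y^* * \top -> x^* <= \top * y * \top.
Proof. by move/le_star; rewrite !starM star_top starK mulgA. Qed.

Section StarIntraRegular.
Variables (d : Order.disp_t) (S : involutionPoeSemigroupType d).
Hypothesis Sreg : star_intra_regular S.

Lemma star_intra_regular_mul (x a b : S) :
  x <= \top * a^* * \top -> x <= \top * b^* * \top ->
  x <= \top * (a * b)^* * \top.
Proof.
move=> /star_le_top_mul_top xa /star_le_top_mul_top xb.
(* Regularity bounds [x] through [x^* * x^*]; the left copy is bounded through [b] and the right one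
   through [a]. This order matters: starring [b e a] twice in a row puts [b^*] just before [a^*]. *)
have x_bea : x <= \top * (b * \top * a) * \top.
  apply: le_trans (Sreg x) _; rewrite -[\top * _ * _]mulgA.
  have xx : x^* * x^* <= \top * (b * (\top * \top) * a) * \top.
    apply: le_trans (poe_le_mulr _ xb) (le_trans (poe_le_mull _ xa) _).
    by rewrite !mulgA.
  apply: le_trans (le_top_mul_top xx) _.
  have := top_mul_top_absorb \top \top (b * (\top * \top) * a).
  rewrite !mulgA => /le_trans; apply; rewrite -!mulgA !(mulgA \top \top).
  exact/poe_le_mull/poe_le_mull/poe_le_mulr/lex1.
(* Squaring [(b e a)^* = a^* e b^*] produces the adjacent factor [b^* a^*]. *)
have bea_ab : b * \top * a <= \top * (a * b)^* * \top.
  apply: le_trans (Sreg _) _; rewrite !starM star_top.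
  apply: le_trans (top_mul_top_absorb (a^* * \top) (\top * b^*) _).
  by rewrite !mulgA.
apply: le_trans x_bea (le_trans (le_top_mul_top bea_ab) _).
apply: le_trans (top_mul_top_absorb \top \top _).
by rewrite !mulgA.
Qed.

Lemma star_intra_regular_self (x : S) : x <= \top * x^* * \top.
Proof.
apply: le_trans (Sreg x) _; rewrite -(mulgA (\top * x^*)).
exact/poe_le_mull/lex1.
Qed.

Lemma star_intra_regular_poe_filter (x : S) :
  poe_filter [set y : S | x <= \top * y^* * \top].
Proof.
split=> /=.
- by exists x; exact: star_intra_regular_self.
- exact: star_intra_regular_mul.
- move=> a b; rewrite starM => xab; split; apply: le_trans xab _.
    by rewrite mulgA; do 2!apply: poe_le_mulr; exact: lex1.
  by rewrite mulgA -(mulgA (\top * b^*)); apply/poe_le_mull/lex1.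
- move=> a b xa ab; apply: le_trans xa _.
  exact/le_top_mul_top/le_star.
Qed.

(** Regularity at [y^*] puts [\top * y * y * \top] in [F], and [y] is a factor of it. *)
Lemma star_intra_regular_filter_star (F : set S) (y : S) :
  poe_filter F -> F (y^*) -> F y.
Proof.
move=> FF /(poe_filter_up FF)/(_ (Sreg _)); rewrite starK.
by move=> /(poe_filter_factors FF)[/(poe_filter_factors FF)[]].
Qed.

End StarIntraRegular.

Theorem theorem26 (d : Order.disp_t) (S : involutionPoeSemigroupType d) :
  star_intra_regular S <->
  (forall x : S,
     generated_filter x = [set y : S | x <= \top * y^* * \top]).
Proof.
split=> [Sreg x | N x].
  apply/seteqP; split=> [y|y xy F [FF Fx]].
    apply; split; first exact: star_intra_regular_poe_filter.
    by move=> _ ->; exact: star_intra_regular_self.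
  have := poe_filter_up FF (Fx x erefl) xy.
  move=> /(poe_filter_factors FF)[/(poe_filter_factors FF)[_]] Fy _.
  exact: star_intra_regular_filter_star Fy.
(* For [y := x * x], the description of N(x) is exactly regularity at [x]. *)
have : generated_filter x (x * x).
  by apply: (poe_filter_mul (poe_filter_generated x));
    exact: generated_filter_mem.
by rewrite N /= starM !mulgA.
Qed.
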